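(* Let $n\ge 2$, let $\lambda_1,\lambda_2,A,B>0$ be real constants with $\lambda_1A-\lambda_2B>0$, let $p_1,\dots,p_M\in\mathbb{Z}^n$ ($M\ge1$) be distinct points, let $n_1,\dots,n_M>0$ be real constants, and set $h_3=4\pi\sum_{j=1}^M n_j\delta_{p_j}$. Then there exists a unique bounded nonnegative function $\tilde u:\mathbb{Z}^n\to\mathbb{R}$ satisfying $$-\Delta \tilde u+\lambda_1\bigl(e^{A\tilde u}-1\bigr)+\lambda_2\bigl(e^{-B\tilde u}-1\bigr)-h_3=0\qquad\text{on }\mathbb{Z}^n.$$ It satisfies $0\le u\le\tilde u$ on $\mathbb{Z}^n$, where $u$ is the nonnegative solution, constructed as described in the context, of $$-\Delta u+\lambda_1e^{Au}(e^{Au}-1)+\lambda_2e^{-Bu}(e^{-Bu}-1)-h_3=0\qquad\text{on }\mathbb{Z}^n.$$ Moreover, $$\tilde u(x)=O\bigl(e^{-m\,d(x)}\bigr),\qquad m=\log\Bigl(1+\frac{\lambda_1A-\lambda_2B}{2n}\Bigr).$$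
   Context: On $\mathbb{Z}^n$ write $d(x,y)=\sum_{i=1}^n|x_i-y_i|$ and $d(x)=d(x,0)$; $x\sim y$ means $d(x,y)=1$. The graph Laplacian is $\Delta u(x)=\sum_{y\sim x}(u(y)-u(x))$. $\delta_p$ is the function equal to $1$ at $p$ and $0$ elsewhere. $u(x)=O(e^{-md(x)})$ means $|u(x)|\le Ce^{-md(x)}$ for all $x\in\mathbb{Z}^n$ and some constant $C$. For finite $\Omega\subset\mathbb{Z}^n$, $\partial\Omega=\{y\in\mathbb{Z}^n\setminus\Omega:\exists x\in\Omega,\ y\sim x\}$ and $\overline\Omega=\Omega\cup\partial\Omega$. Construction of $u$. Let $g(t)=\lambda_1e^{At}(e^{At}-1)+\lambda_2e^{-Bt}(e^{-Bt}-1)$, let $M_0>0$ be such that $g(M_0)=4\pi\max_jn_j$, and let $L>0$ be sufficiently large (so that in particular $t\mapsto g(t)-Lt$ is decreasing on $[0,M_0]$). For a finite set $\Omega$, put $u_0=0$ and let $u_{k+1}:\overline\Omega\to\mathbb{R}$ be the unique solution of $(\Delta-L)u_{k+1}=g(u_k)-h_3-Lu_k$ in $\Omega$, $u_{k+1}=0$ on $\partial\Omega$. The sequence $(u_k)$ is nondecreasing with values in $[0,M_0]$; let $u_\Omega$ be its pointwise limit. Let $\Omega_0\subset\Omega_1\subset\cdots$ be finite connected subsets of $\mathbb{Z}^n$ with $\{p_1,\dots,p_M\}\subset\Omega_0$ and $\bigcup_k\Omega_k=\mathbb{Z}^n$. Extending each $u_{\Omega_k}$ by $0$ outside $\Omega_k$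 gives a nondecreasing sequence of functions on $\mathbb{Z}^n$ with values in $[0,M_0]$, and $u$ is its pointwise limit; it solves the second equation in the claim and satisfies $u(x)=O(e^{-md(x)})$. *)

(* Defs.v *)
From HB Require Import structures.
From mathcomp Require Import all_boot all_order all_algebra.
From mathcomp Require Import all_classical all_reals all_analysis.

Set Implicit Arguments.
Unset Strict Implicit.
Unset Printing Implicit Defensive.

Import Order.TTheory GRing.Theory Num.Theory.
Import numFieldNormedType.Exports.

Local Open Scope classical_set_scope.
Local Open Scope ring_scope.

Section Lattice.
Variables (R : realType) (n : nat).

Notation Zn := 'rV[int]_n.

Definition dist (x y : Zn) : int := \sum_(i < n) `|x 0 i - y 0 i|.

Definition adj : rel Zn := fun x y => dist x y == 1.

(* A sum over a finitely supported set: x has exactly 2n neighbours. *)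
Definition laplacian (u : Zn -> R) (x : Zn) : R :=
  \sum_(y \in [set y | adj x y]) (u y - u x).

Definition delta (p x : Zn) : R := (x == p)%:R.

Definition boundary (Omega : set Zn) : set Zn :=
  [set y | ~ Omega y /\ exists2 x, Omega x & adj x y].

Definition graph_connected (Omega : set Zn) : Prop :=
  forall x y, Omega x -> Omega y ->
    exists s : seq Zn,
      [/\ path adj x s, last x s = y & forall z, z \in s -> Omega z].

(* [xget] returns a function meeting both conditions whenever there is one.
   They determine its values on the closure of Omega; the values elsewhere are
   arbitrary and are never used. *)
Definition next_iterate (g : R -> R) (h : Zn -> R) (L : R) (Omega : set Zn)
    (v : Zn -> R) : Zn -> R :=
  xget (fun=> 0) [set w : Zn -> R |
    (forall x, Omega x ->
       laplacian w x - L * w x = g (v x) - h x - L * v x) /\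
    (forall x, boundary Omega x -> w x = 0)].

Definition iterate (g : R -> R) (h : Zn -> R) (L : R) (Omega : set Zn)
    (k : nat) : Zn -> R :=
  iter k (next_iterate g h L Omega) (fun=> 0).

Definition domain_solution (g : R -> R) (h : Zn -> R) (L : R)
    (Omega : set Zn) (x : Zn) : R :=
  limn (fun k => iterate g h L Omega k x).

Definition exhaustion (P : set Zn) (Omega : nat -> set Zn) : Prop :=
  [/\ forall k, finite_set (Omega k),
      forall k, graph_connected (Omega k),
      P `<=` Omega 0%N,
      forall k, Omega k `<=` Omega k.+1 &
      \bigcup_k Omega k = setT].

(* [patch (fun=> 0) D f] is f on D and 0 off D. *)
Definition lattice_solution (g : R -> R) (h : Zn -> R) (L : R)
    (Omega : nat -> set Zn) (x : Zn) : R :=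
  limn (fun k => patch (fun=> 0) (Omega k) (domain_solution g h L (Omega k)) x).

End Lattice.

Definition vortex_source (R : realType) (n M : nat) (p : 'I_M -> 'rV[int]_n)
    (mult : 'I_M -> R) (x : 'rV[int]_n) : R :=
  4 * pi * \sum_(j < M) mult j * delta R (p j) x.

Definition nonlinearity (R : realType) (lambda1 lambda2 A B t : R) : R :=
  lambda1 * expR (A * t) * (expR (A * t) - 1) +
  lambda2 * expR (- B * t) * (expR (- B * t) - 1).

(* Main.v *)
(** Everything rests on one maximum principle on Z^n: if v is bounded above and
    c v <= laplacian v wherever v > 0, with c > 0, then v <= 0; no decay at
    infinity is required.  Write f t for the nonlinearity of the equation for the
    bounded solution ut and g t for the other one.  On [0, +oo[ both have slope at
    least c = lambda1 A - lambda2 B, and f <= g because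
    g - f = lambda1 (e^{At} - 1)^2 + lambda2 (1 - e^{-Bt})^2.
    Applied to differences, the principle gives uniqueness of ut, monotonicity of
    the solutions on growing domains, the bound u <= ut, and the decay of ut by
    comparison with C e^{-m d}.  Existence is by monotone iteration from 0. *)
Require Import Defs.
From HB Require Import structures.
From mathcomp Require Import all_boot all_order all_algebra.
From mathcomp Require Import all_classical all_reals all_analysis.
From mathcomp Require Import ring lra.

Set Implicit Arguments.
Unset Strict Implicit.
Unset Printing Implicit Defensive.

Import Order.TTheory GRing.Theory Num.Theory.
Import numFieldNormedType.Exports.

Local Open Scope classical_set_scope.
Local Open Scope ring_scope.

(** * The graph Laplacian on Z^n and its maximum principle *)

(** A coordinate where x and y differ already contributes an integer at least 1 to the distance 1,
    so all other coordinates agree. *)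
Lemma adj_delta (n : nat) (x y : 'rV[int]_n) : adj x y ->
  exists i : 'I_n, y = x + delta_mx 0 i \/ y = x - delta_mx 0 i.
Proof.
move=> /eqP dxy.
have [i ni|all0] := pickP (fun i : 'I_n => x 0 i != y 0 i); last first.
  suff: dist x y = 0 by rewrite dxy.
  by rewrite /dist big1// => i _; have /negbFE/eqP -> := all0 i; rewrite subrr normr0.
have d1 : 1 <= `|x 0 i - y 0 i| by rewrite -gtz0_ge1 normr_gt0 subr_eq0.
have r0 : 0 <= \sum_(j < n | j != i) `|x 0 j - y 0 j| by exact: sumr_ge0.
move: dxy; rewrite /dist (bigD1 i)//= => dxy.
have s0 : \sum_(j < n | j != i) `|x 0 j - y 0 j| = 0.
  by apply/eqP; rewrite eq_le r0 andbT -(lerD2l `|x 0 i - y 0 i|) dxy addr0.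
have {}dxy : `|x 0 i - y 0 i| = 1 by rewrite s0 addr0 in dxy.
have yj j : j != i -> y 0 j = x 0 j.
  move=> ji; move/eqP: s0; rewrite psumr_eq0// => /allP/(_ j).
  by rewrite mem_index_enum ji normr_eq0 subr_eq0 => /(_ isT)/eqP.
exists i; have [xy|xy] := leP 0 (x 0 i - y 0 i).
- right; apply/rowP => j; rewrite !mxE eqxx/=.
  have [->|ji] := eqVneq j i; last by rewrite yj// subr0.
  by rewrite -dxy ger0_norm// opprB addrC subrK.
- left; apply/rowP => j; rewrite !mxE eqxx/=.
  have [->|ji] := eqVneq j i; last by rewrite yj// addr0.
  by rewrite -dxy ltr0_norm// opprB addrC subrK.
Qed.

(** A duplicate-free list turns the finitely supported sum in [laplacian] into a sum over a
    sequence; filtering by [adj] makes membership exactly adjacency. *)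
Definition neighbours (n : nat) (x : 'rV[int]_n) : seq 'rV[int]_n :=
  [seq y <- undup ([seq x + delta_mx 0 i | i : 'I_n] ++
                   [seq x - delta_mx 0 i | i : 'I_n]) | adj x y].

Lemma mem_neighbours (n : nat) (x y : 'rV[int]_n) :
  (y \in neighbours x) = adj x y.
Proof.
rewrite mem_filter; have [/adj_delta[i xy]|//] := boolP (adj x y).
rewrite mem_undup mem_cat; case: xy => ->; apply/orP; [left|right];
  by apply/mapP; exists i; rewrite ?mem_enum.
Qed.

Lemma size_neighbours (n : nat) (x : 'rV[int]_n) : (size (neighbours x) <= 2 * n)%N.
Proof.
rewrite size_filter (leq_trans (count_size _ _))// (leq_trans (size_undup _))//.
by rewrite size_cat !size_map -enumT size_enum_ord mul2n addnn.
Qed.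

Lemma laplacianE (R : realType) (n : nat) (u : 'rV[int]_n -> R) (x : 'rV[int]_n) :
  laplacian u x = \sum_(y <- neighbours x) (u y - u x).
Proof.
rewrite fsbig_seq ?filter_uniq ?undup_uniq// /laplacian.
suff -> : [set y | adj x y] = [set` neighbours x] by [].
by apply/seteqP; split=> y /=; rewrite mem_neighbours.
Qed.

Lemma eq_laplacian (R : realType) (n : nat) (u v : 'rV[int]_n -> R) (x : 'rV[int]_n) :
  u x = v x -> (forall y, adj x y -> u y = v y) -> laplacian u x = laplacian v x.
Proof.
move=> ux uv; rewrite !laplacianE; apply: eq_big_seq => y.
by rewrite mem_neighbours => /uv ->; rewrite ux.
Qed.

Lemma laplacianB (R : realType) (n : nat) (u v : 'rV[int]_n -> R) (x : 'rV[int]_n) :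
  laplacian (fun y => u y - v y) x = laplacian u x - laplacian v x.
Proof.
by rewrite !laplacianE -sumrB; apply: eq_bigr => y _; ring.
Qed.

Lemma laplacian_cst (R : realType) (n : nat) (k : R) (x : 'rV[int]_n) :
  laplacian (fun=> k) x = 0.
Proof. by rewrite laplacianE big1// => y _; rewrite subrr. Qed.

Lemma laplacian_le (R : realType) (n : nat) (u : 'rV[int]_n -> R) (x : 'rV[int]_n) (k : R) :
  0 <= k -> (forall y, adj x y -> u y - u x <= k) ->
  laplacian u x <= (2 * n)%:R * k.
Proof.
move=> k0 uk; rewrite laplacianE.
apply: (@le_trans _ _ (\sum_(y <- neighbours x) k)).
  by rewrite !big_seq ler_sum// => y; rewrite mem_neighbours => /uk.
rewrite big_const_seq count_predT iter_addr_0 -[k *+ _]mulr_natl.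
by rewrite ler_wpM2r// ler_nat size_neighbours.
Qed.

(** Adding 2n u(x) cancels the negative diagonal part of the Laplacian: what remains is a
    combination of values of u with nonnegative coefficients. This makes the explicit iteration step
    order preserving. *)
Lemma laplacian_mono (R : realType) (n : nat) (u v : 'rV[int]_n -> R) (x : 'rV[int]_n) :
  (forall y, u y <= v y) ->
  (2 * n)%:R * u x + laplacian u x <= (2 * n)%:R * v x + laplacian v x.
Proof.
move=> uv.
have : laplacian (fun y => u y - v y) x <= (2 * n)%:R * (v x - u x).
  apply: laplacian_le => [|y _]; first by rewrite subr_ge0.
  by move: (uv y); lra.
by rewrite laplacianB mulrBr; lra.
Qed.

Lemma cvg_laplacian (R : realType) (n : nat) (u : nat -> 'rV[int]_n -> R)
    (v : 'rV[int]_n -> R) (x : 'rV[int]_n) :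
  (forall y, u k y @[k --> \oo] --> v y) ->
  laplacian (u k) x @[k --> \oo] --> laplacian v x.
Proof.
move=> uv; rewrite laplacianE.
under eq_fun do rewrite laplacianE.
by apply: cvg_big => [|y _]; [exact: add_continuous|exact: cvgB].
Qed.

(* At a point where v is close to its supremum S > 0, the Laplacian is at most
   2n (S - v), so c v <= 2n (S - v) forces S <= 2n/(2n + c) S. *)
Lemma maximum_principle (R : realType) (n : nat) (c K : R) (v : 'rV[int]_n -> R) :
  0 < c -> (forall x, v x <= K) ->
  (forall x, 0 < v x -> c * v x <= laplacian v x) ->
  forall x, v x <= 0.
Proof.
move=> c0 vK sub x; rewrite leNgt; apply/negP => vx.
have hs : has_sup (range v).
  by split; [exists (v x), x | exists K => _ [y _ <-]].
pose S := sup (range v).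
have vS y : v y <= S by apply: sup_upper_bound => //; exists y.
have S0 : 0 < S by exact: lt_le_trans (vS x).
have N0 : 0 <= (2 * n)%:R :> R by rewrite ler0n.
have Nc : 0 < (2 * n)%:R + c by rewrite ltr_wpDl.
suff : S <= (2 * n)%:R * S / ((2 * n)%:R + c).
  by rewrite ler_pdivlMr// mulrDr mulrC gerDl pmulr_rle0// leNgt c0.
apply: ge_sup => [|_ [y _ <-]]; first by exists (v x), x.
rewrite ler_pdivlMr//; have [vy|vy] := leP (v y) 0.
  by apply: (@le_trans _ _ 0); [rewrite mulr_le0_ge0// ltW|rewrite mulr_ge0// ltW].
have : laplacian v y <= (2 * n)%:R * (S - v y).
  by apply: laplacian_le => [|z _]; [rewrite subr_ge0|rewrite lerD2r].
by move: (sub y vy); rewrite mulrBr mulrDr ![v y * _]mulrC; lra.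
Qed.

(** * Monotone limits, existence by iteration, comparison *)

Lemma cvgn_unique (R : realType) (u : nat -> R) (a b : R) :
  u k @[k --> \oo] --> a -> u k @[k --> \oo] --> b -> a = b.
Proof. by move=> ua ub; rewrite -(cvg_lim _ ua)// -(cvg_lim _ ub). Qed.

Lemma bounded_nondecreasing_cvg (R : realType) (u : nat -> R) (K : R) :
  (forall k, u k <= u k.+1) -> (forall k, u k <= K) ->
  [/\ u k @[k --> \oo] --> limn u, forall k, u k <= limn u & limn u <= K].
Proof.
move=> uS uK.
have und : {homo u : a b / (a <= b)%N >-> a <= b} by apply/nondecreasing_seqP.
have uc : cvgn u by apply: nondecreasing_is_cvgn => //; exists K => _ [k _ <-].
split=> //; first by move=> k; exact: nondecreasing_cvgn_le.
by apply: limr_le => //; exact: nearW.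
Qed.

(* Monotone iteration from the subsolution 0 below the supersolution M1: adding
   K t makes the right-hand side monotone, so the explicit step below is
   order preserving and no linear problem has to be solved. *)
Lemma exists_solution (R : realType) (n : nat) (Omega : set 'rV[int]_n)
    (F : 'rV[int]_n -> R -> R) (K M1 : R) :
  0 < K -> 0 <= M1 ->
  (forall x, Omega x -> F x 0 <= 0) -> (forall x, Omega x -> 0 <= F x M1) ->
  (forall x s t, 0 <= s -> s <= t -> t <= M1 -> F x t - F x s <= K * (t - s)) ->
  (forall x, continuous (F x)) ->
  exists w : 'rV[int]_n -> R,
    [/\ forall x, 0 <= w x <= M1,
        forall x, Omega x -> laplacian w x = F x (w x) &
        forall x, ~ Omega x -> w x = 0].
Proof.
move=> K0 M10 F0 F1 FK Fc.
have D0 : 0 < (2 * n)%:R + K by rewrite ltr_wpDl.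
(* A relaxation step: on [Omega] its fixed points are exactly the solutions, and off [Omega] it
   imposes the value 0. *)
pose T (w : 'rV[int]_n -> R) : 'rV[int]_n -> R := patch (fun=> 0) Omega
  (fun x => w x + (laplacian w x - F x (w x)) / ((2 * n)%:R + K)).
have Tin w x : Omega x ->
    T w x = w x + (laplacian w x - F x (w x)) / ((2 * n)%:R + K).
  by move=> Ox; rewrite /T patchT// inE.
have Tout w x : ~ Omega x -> T w x = 0 by move=> Ox; rewrite /T patchC// inE.
have Tle u v : (forall x, 0 <= u x) -> (forall x, u x <= v x) ->
    (forall x, v x <= M1) -> forall x, T u x <= T v x.
  move=> u0 uv vM x; have [Ox|Ox] := pselect (Omega x); last by rewrite !Tout.
  (* Multiplied by 2n + K, the step splits into 2n w + laplacian w and K w - F(w), each monotone in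
     w. *)
  rewrite !Tin// -(ler_pM2r D0) !mulrDl !mulfVK ?gt_eqF//.
  have := laplacian_mono x uv; have := FK x _ _ (u0 x) (uv x) (vM x).
  by rewrite ![_ * ((2 * n)%:R + K)]mulrC !mulrDl mulrBr; lra.
pose w k := iter k T (fun=> 0).
have w_bounds k : (forall x, 0 <= w k x) /\ (forall x, w k x <= M1).
  elim: k => [//|k [ih0 ihM]]; split=> x /=.
    (* The sign conditions on F at 0 and at M1 give 0 <= T 0 and T M1 <= M1; order preservation
       keeps every iterate in between. *)
    apply: (@le_trans _ _ (T (fun=> 0) x)); last exact: Tle.
    have [Ox|Ox] := pselect (Omega x); last by rewrite Tout.
    by rewrite Tin// laplacian_cst add0r sub0r divr_ge0 ?oppr_ge0 ?F0// ltW.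
  apply: (@le_trans _ _ (T (fun=> M1) x)); first exact: Tle.
  have [Ox|Ox] := pselect (Omega x); last by rewrite Tout.
  by rewrite Tin// laplacian_cst sub0r gerDl mulr_le0_ge0 ?oppr_le0 ?F1 ?invr_ge0// ltW.
have wS k : forall x, w k x <= w k.+1 x.
  elim: k => [|k ih] x; first by have [] := w_bounds 1%N.
  have [w0 _] := w_bounds k; have [_ wM] := w_bounds k.+1; exact: Tle.
have wcvg x := bounded_nondecreasing_cvg (wS^~ x) (fun k => (w_bounds k).2 x).
exists (fun x => limn (w^~ x)); split=> x.
- have [_ wl ->] := wcvg x; rewrite andbT.
  by apply: le_trans (wl 0%N).
- move=> Ox.
  have Tcvg : w k.+1 x @[k --> \oo] -->
      limn (w^~ x) + (laplacian (fun x => limn (w^~ x)) x - F x (limn (w^~ x)))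
         / ((2 * n)%:R + K).
    rewrite /= (_ : (fun k => w k.+1 x) = (fun k => w k x +
      (laplacian (w k) x - F x (w k x)) / ((2 * n)%:R + K))); last first.
      by apply/funext => k; rewrite -Tin.
    apply: cvgD; first by case: (wcvg x).
    apply: cvgMr_tmp; apply: cvgB.
      by apply: cvg_laplacian => y; case: (wcvg y).
    by apply: (continuous_cvg _ (Fc x _)); case: (wcvg x).
  have wlim : w k.+1 x @[k --> \oo] --> limn (w^~ x).
    by rewrite (cvg_shiftS (w^~ x)); case: (wcvg x).
  have /eqP := cvgn_unique Tcvg wlim.
  rewrite -subr_eq0 addrAC subrr add0r mulf_eq0 invr_eq0 (gt_eqF D0) orbF.
  by rewrite subr_eq0 => /eqP.
- move=> Ox; apply: lim_near_cst => //; near=> k.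
  have : (0 < k)%N by near: k; exists 1%N.
  by case: (k) => //= j _; rewrite Tout.
Unshelve. all: by end_near. Qed.

(** The maximum principle for u - v: the exterior inequality confines the set where u > v to
    [Omega], which may be infinite or the whole lattice. *)
Lemma comparison (R : realType) (n : nat) (Omega : set 'rV[int]_n) (c K : R)
    (u v : 'rV[int]_n -> R) :
  0 < c -> (forall x, u x - v x <= K) ->
  (forall x, ~ Omega x -> u x <= v x) ->
  (forall x, Omega x -> v x < u x ->
     c * (u x - v x) <= laplacian u x - laplacian v x) ->
  forall x, u x <= v x.
Proof.
move=> c0 uvK out sub x; rewrite -subr_le0.
apply: (maximum_principle (v := fun x => u x - v x) c0 uvK) => y.
have [Oy|/out uvy] := pselect (Omega y); last by rewrite subr_gt0 ltNge uvy.
by rewrite subr_gt0 laplacianB => /(sub y Oy).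
Qed.

(** * The two nonlinearities *)

Definition exp_nonlinearity (R : realType) (lambda1 lambda2 A B t : R) : R :=
  lambda1 * (expR (A * t) - 1) + lambda2 * (expR (- B * t) - 1).

(** Convexity: exp lies above its tangent at s. This is 1 + x <= e^x at x = t - s, scaled by e^s. *)
Lemma expR_tangent (R : realType) (s t : R) :
  expR s * (t - s) <= expR t - expR s.
Proof.
have := expR_ge1Dx (t - s); rewrite -(ler_pM2l (expR_gt0 s)) -expRD.
by rewrite (addrC s) subrK mulrDr mulr1; lra.
Qed.

(** Tangents are taken at the left endpoint s >= 0, where e^{As} >= 1 and e^{-Bs} <= 1; the slopes
    are thus at least A and -B. *)
Lemma exp_nonlinearity_incr (R : realType) (l1 l2 A B s t : R) :
  0 <= l1 -> 0 <= l2 -> 0 <= A -> 0 <= B -> 0 <= s -> s <= t ->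
  (l1 * A - l2 * B) * (t - s) <=
  exp_nonlinearity l1 l2 A B t - exp_nonlinearity l1 l2 A B s.
Proof.
move=> l10 l20 A0 B0 s0 st; rewrite /exp_nonlinearity.
have st0 : 0 <= t - s by rewrite subr_ge0.
have hA : A * (t - s) <= expR (A * t) - expR (A * s).
  apply: le_trans (expR_tangent _ _); rewrite -mulrBr ler_peMl ?mulr_ge0//.
  by rewrite -expR0 ler_expR mulr_ge0.
have hB : - B * (t - s) <= expR (- B * t) - expR (- B * s).
  apply: le_trans (expR_tangent _ _); rewrite -mulrBr mulNr mulrN lerN2.
  by rewrite ler_piMl ?mulr_ge0// -expR0 ler_expR mulNr oppr_le0 mulr_ge0.
have := ler_wpM2l l10 hA; have := ler_wpM2l l20 hB; lra.
Qed.

(** The B-term is nonincreasing, so only the A-term can raise the difference; the tangent at the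
    right endpoint t bounds it. *)
Lemma exp_nonlinearity_lip (R : realType) (l1 l2 A B s t M1 : R) :
  0 <= l1 -> 0 <= l2 -> 0 <= A -> 0 <= B -> s <= t -> t <= M1 ->
  exp_nonlinearity l1 l2 A B t - exp_nonlinearity l1 l2 A B s <=
  l1 * (A * expR (A * M1)) * (t - s).
Proof.
move=> l10 l20 A0 B0 st tM; rewrite /exp_nonlinearity.
have st0 : 0 <= t - s by rewrite subr_ge0.
have hA : expR (A * t) - expR (A * s) <= A * expR (A * M1) * (t - s).
  have := expR_tangent (A * t) (A * s).
  have : expR (A * t) * (A * (t - s)) <= expR (A * M1) * (A * (t - s)).
    by rewrite ler_wpM2r ?mulr_ge0// ler_expR ler_wpM2l.
  by lra.
have hB : expR (- B * t) <= expR (- B * s) by rewrite ler_expR !mulNr lerN2 ler_wpM2l.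
have := ler_wpM2l l10 hA; have := ler_wpM2l l20 hB; lra.
Qed.

Lemma exp_nonlinearity0 (R : realType) (l1 l2 A B : R) :
  exp_nonlinearity l1 l2 A B 0 = 0.
Proof. by rewrite /exp_nonlinearity !mulr0 expR0 subrr !mulr0 addr0. Qed.

Lemma cvg_expRM (R : realType) (a t : R) : expR (a * s) @[s --> t] --> expR (a * t).
Proof.
by apply: (continuous_cvg _ (@continuous_expR _ _)); apply: cvgMl_tmp; exact: cvg_id.
Qed.

Lemma continuous_exp_nonlinearity (R : realType) (l1 l2 A B : R) :
  continuous (exp_nonlinearity l1 l2 A B).
Proof.
move=> t; apply: cvgD; apply: cvgMl_tmp; apply: cvgB; try exact: cvg_cst;
  exact: cvg_expRM.
Qed.

Lemma nonlinearityE (R : realType) (l1 l2 A B t : R) :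
  nonlinearity l1 l2 A B t = exp_nonlinearity l1 l2 A B t +
    (l1 * (expR (A * t) - 1) ^+ 2 + l2 * (1 - expR (- B * t)) ^+ 2).
Proof. by rewrite /nonlinearity /exp_nonlinearity; ring. Qed.

Lemma le_exp_nonlinearity (R : realType) (l1 l2 A B t : R) : 0 <= l1 -> 0 <= l2 ->
  exp_nonlinearity l1 l2 A B t <= nonlinearity l1 l2 A B t.
Proof. by move=> ? ?; rewrite nonlinearityE lerDl addr_ge0 // mulr_ge0 ?sqr_ge0. Qed.

(** The slope bound passes from f to g because e^{At} - 1 and 1 - e^{-Bt} are nonnegative and
    nondecreasing for t >= 0, hence so are their squares. *)
Lemma nonlinearity_incr (R : realType) (l1 l2 A B s t : R) :
  0 <= l1 -> 0 <= l2 -> 0 <= A -> 0 <= B -> 0 <= s -> s <= t ->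
  (l1 * A - l2 * B) * (t - s) <= nonlinearity l1 l2 A B t - nonlinearity l1 l2 A B s.
Proof.
move=> l10 l20 A0 B0 s0 st; rewrite !nonlinearityE.
have := exp_nonlinearity_incr l10 l20 A0 B0 s0 st.
have hA : (expR (A * s) - 1) ^+ 2 <= (expR (A * t) - 1) ^+ 2.
  have sA : expR 0 <= expR (A * s) by rewrite ler_expR mulr_ge0.
  have tA : expR (A * s) <= expR (A * t) by rewrite ler_expR ler_wpM2l.
  by rewrite expR0 in sA; rewrite ler_pXn2r ?nnegrE//; lra.
have hB : (1 - expR (- B * s)) ^+ 2 <= (1 - expR (- B * t)) ^+ 2.
  have sB : expR (- B * s) <= expR 0 by rewrite ler_expR mulNr oppr_le0 mulr_ge0.
  have tB : expR (- B * t) <= expR (- B * s) by rewrite ler_expR !mulNr lerN2 ler_wpM2l.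
  by rewrite expR0 in sB; rewrite ler_pXn2r ?nnegrE//; lra.
have := ler_wpM2l l10 hA; have := ler_wpM2l l20 hB; lra.
Qed.

Lemma nonlinearity0 (R : realType) (l1 l2 A B : R) : nonlinearity l1 l2 A B 0 = 0.
Proof. by rewrite /nonlinearity !mulr0 expR0 subrr !mulr0 addr0. Qed.

Lemma continuous_nonlinearity (R : realType) (l1 l2 A B : R) :
  continuous (nonlinearity l1 l2 A B).
Proof.
move=> t; apply: cvgD; apply: cvgM; try (by apply: cvgMl_tmp; exact: cvg_expRM);
  apply: cvgB; try exact: cvg_cst; exact: cvg_expRM.
Qed.

(** * Bounds on the source *)

Lemma vortex_source_ge0 (R : realType) (n M : nat) (p : 'I_M -> 'rV[int]_n)
    (mult : 'I_M -> R) (x : 'rV[int]_n) :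
  (forall j, 0 <= mult j) -> 0 <= vortex_source p mult x.
Proof.
move=> m0; rewrite !mulr_ge0 ?pi_ge0// sumr_ge0// => j _.
by rewrite mulr_ge0// ler0n.
Qed.

Lemma vortex_source_out (R : realType) (n M : nat) (p : 'I_M -> 'rV[int]_n)
    (mult : 'I_M -> R) (x : 'rV[int]_n) :
  ~ range p x -> vortex_source p mult x = 0.
Proof.
move=> px; rewrite /vortex_source big1 ?mulr0// => j _.
by rewrite /delta; case: eqP => [xp|]; [case: px; exists j|rewrite mulr0].
Qed.

(** Since the vortices are distinct, at most one term is nonzero at each site; hence a maximum and
    not a sum. It matches the value prescribed for g(M0). *)
Lemma vortex_source_le (R : realType) (n M : nat) (p : 'I_M -> 'rV[int]_n)
    (mult : 'I_M -> R) (x : 'rV[int]_n) :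
  injective p ->
  vortex_source p mult x <= 4 * pi * \big[Num.max/0]_(j < M) mult j.
Proof.
move=> pinj; have pi40 : 0 <= 4 * pi :> R by rewrite mulr_ge0 ?pi_ge0.
have [[j _ <-]|px] := pselect (range p x); last first.
  by rewrite vortex_source_out// mulr_ge0// bigmax_ge_id.
rewrite ler_wpM2l// (bigD1 j)//= big1 ?addr0 => [|i ij].
  by rewrite /delta eqxx mulr1; exact: le_bigmax.
by rewrite /delta (inj_eq pinj) eq_sym (negbTE ij) mulr0.
Qed.

Lemma finite_set_bounded (R : realType) (T : choiceType) (D : set T)
    (f : T -> R) :
  finite_set D -> exists K, forall x, D x -> `|f x| <= K.
Proof.
move=> /finite_seqP[s ->]; exists (\sum_(x <- s) `|f x|) => x /= xs.
by rewrite (big_rem x)//= lerDl sumr_ge0.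
Qed.

(** * The prescribed construction: iterates, solutions on finite domains, limit on the lattice *)

Section MonotoneScheme.
Variables (R : realType) (n : nat) (g : R -> R) (h : 'rV[int]_n -> R) (c L M0 : R).
Hypotheses (c0 : 0 < c) (L0 : 0 < L) (M00 : 0 <= M0).
Hypotheses (h0 : forall x, 0 <= h x) (hM0 : forall x, h x <= g M0).
Hypotheses (gc : continuous g) (g0 : g 0 = 0).
Hypothesis g_incr : forall s t, 0 <= s -> s <= t -> c * (t - s) <= g t - g s.
Hypothesis gL : forall s t, 0 <= s -> s <= t -> t <= M0 -> g t - L * t <= g s - L * s.

(** The function picked by [xget] is controlled only on the closure of [Omega], so it is replaced by
    its extension by 0. Comparison with slope L identifies this with the solution z of
    [exists_solution], whose bounds it inherits. *)
Lemma next_iterateP (Omega : set 'rV[int]_n) (v : 'rV[int]_n -> R) :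
  finite_set Omega -> (forall x, Omega x -> 0 <= v x <= M0) ->
  let w := patch (fun=> 0) Omega (next_iterate g h L Omega v) in
  (forall x, 0 <= w x <= M0) /\
  (forall x, Omega x -> laplacian w x = L * w x + (g (v x) - h x - L * v x)).
Proof.
move=> Ofin vM w.
have [z [zM zeq zout]] : exists z : 'rV[int]_n -> R,
    [/\ forall x, 0 <= z x <= M0,
        forall x, Omega x -> laplacian z x = L * z x + (g (v x) - h x - L * v x) &
        forall x, ~ Omega x -> z x = 0].
  (* The sign conditions at 0 and M0 come from the decrease of g(t) - L t: g(v) - L v lies between
     g(M0) - L M0 and g(0) = 0, while 0 <= h <= g(M0). *)
  apply: (exists_solution
    (F := fun x t => L * t + (g (v x) - h x - L * v x)) L0 M00).
  - move=> x /vM/andP[vx0 vxM].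
    by have := gL (lexx 0) vx0 vxM; rewrite g0; move: (h0 x); lra.
  - move=> x /vM/andP[vx0 vxM].
    by have := gL vx0 vxM (lexx _); move: (hM0 x); lra.
  - by move=> x s t _ _ _; lra.
  - move=> x t; apply: cvgD; last exact: cvg_cst.
    by apply: cvgM; [exact: cvg_cst|exact: cvg_id].
have [weq wbd] : (forall x, Omega x -> laplacian (next_iterate g h L Omega v) x -
      L * next_iterate g h L Omega v x = g (v x) - h x - L * v x) /\
    (forall x, boundary Omega x -> next_iterate g h L Omega v x = 0).
  (* The solution z is a witness, which rules out the default value of [xget]. *)
  rewrite /next_iterate; case: xgetP => [_ _ //|/(_ z)[]].
  split=> x; last by move=> [/zout].
  by move=> /zeq ->; lra.
have win x : Omega x -> w x = next_iterate g h L Omega v x.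
  by move=> Ox; rewrite /w patchT// inE.
have wout x : ~ Omega x -> w x = 0 by move=> Ox; rewrite /w patchC// inE.
have wlap x : Omega x -> laplacian w x = L * w x + (g (v x) - h x - L * v x).
  move=> Ox; rewrite win// -weq// addrC subrK; apply: eq_laplacian => [|y xy].
    exact: win.
  have [/win//|Oy] := pselect (Omega y).
  by rewrite wout// wbd//; split=> //; exists x.
(* Comparison requires a bound on w beforehand; finiteness of [Omega] supplies one. *)
have [K wK] := finite_set_bounded w Ofin.
have K0 x : `|w x| <= `|K|.
  have [/wK wxK|/wout ->] := pselect (Omega x); last by rewrite normr0.
  by rewrite (le_trans wxK)// ler_norm.
have wK1 x : - `|K| <= w x <= `|K| by rewrite -ler_norml.
have wz : w = z.
  apply/funext => x; apply/eqP; rewrite eq_le; apply/andP; split; move: x.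
  - apply: (comparison (Omega := Omega) (K := `|K|) L0) => x.
    + by move: (wK1 x) (zM x) => /andP[? ?] /andP[? ?]; lra.
    + by move=> Ox; rewrite wout// zout.
    + by move=> Ox _; rewrite wlap// zeq//; lra.
  - apply: (comparison (Omega := Omega) (K := M0 + `|K|) L0) => x.
    + by move: (wK1 x) (zM x) => /andP[? ?] /andP[? ?]; lra.
    + by move=> Ox; rewrite wout// zout.
    + by move=> Ox _; rewrite wlap// zeq//; lra.
by split=> // x; rewrite wz.
Qed.

Lemma iterateP (Omega : set 'rV[int]_n) : finite_set Omega ->
  let w k := patch (fun=> 0) Omega (iterate g h L Omega k) in
  [/\ forall k x, 0 <= w k x <= M0,
      forall k x, w k x <= w k.+1 x &
      forall k x, Omega x -> laplacian (w k.+1) x =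
        L * w k.+1 x + (g (w k x) - h x - L * w k x)].
Proof.
move=> Ofin w.
have win k x : Omega x -> w k x = iterate g h L Omega k x.
  by move=> Ox; rewrite /w patchT// inE.
have wout k x : ~ Omega x -> w k x = 0 by move=> Ox; rewrite /w patchC// inE.
have w0 x : w 0%N x = 0 by rewrite /w /patch; case: ifP.
have wM k x : 0 <= w k x <= M0.
  elim: k x => [x|k ih]; first by rewrite w0 lexx.
  have vM x : Omega x -> 0 <= iterate g h L Omega k x <= M0.
    by move=> Ox; rewrite -win.
  by have [] := next_iterateP Ofin vM.
have weq k x : Omega x -> laplacian (w k.+1) x =
    L * w k.+1 x + (g (w k x) - h x - L * w k x).
  have vM y : Omega y -> 0 <= iterate g h L Omega k y <= M0.
    by move=> Oy; rewrite -win.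
  by move=> Ox; have [_ /(_ x Ox)] := next_iterateP Ofin vM; rewrite -win.
split=> //; elim=> [|k ih] x.
  by rewrite w0; case/andP: (wM 1%N x).
apply: (comparison (Omega := Omega) (K := M0) L0) x => x.
- by move: (wM k.+1 x) (wM k.+2 x) => /andP[? ?] /andP[? ?]; lra.
- by move=> Ox; rewrite !wout.
(* Since w_k <= w_{k+1}, the decrease of g(t) - L t orders the right-hand sides, and the slope L
   remains for the comparison. *)
- move=> Ox _; rewrite !weq//.
  case/andP: (wM k x) => k0 _; case/andP: (wM k.+1 x) => _ k1.
  by have := gL k0 (ih x) k1; lra.
Qed.

Lemma domain_solutionP (Omega : set 'rV[int]_n) : finite_set Omega ->
  let u := patch (fun=> 0) Omega (domain_solution g h L Omega) in
  [/\ forall x, 0 <= u x <= M0,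
      forall x, ~ Omega x -> u x = 0 &
      forall x, Omega x -> laplacian u x = g (u x) - h x].
Proof.
move=> Ofin u; pose w k := patch (fun=> 0) Omega (iterate g h L Omega k).
have wM k x : 0 <= w k x <= M0 by have [+ _ _] := iterateP Ofin; exact.
have wS k x : w k x <= w k.+1 x by have [_ + _] := iterateP Ofin; exact.
have weq k x : Omega x -> laplacian (w k.+1) x =
    L * w k.+1 x + (g (w k x) - h x - L * w k x).
  by have [_ _] := iterateP Ofin; exact.
have uout x : ~ Omega x -> u x = 0 by move=> Ox; rewrite /u patchC// inE.
have wu x : w k x @[k --> \oo] --> u x.
  have wxM k : w k x <= M0 by case/andP: (wM k x).
  have [wc _ _] := bounded_nondecreasing_cvg (wS^~ x) wxM.
  suff -> : u x = limn (w^~ x) by [].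
  have [Ox|Ox] := pselect (Omega x).
    rewrite (_ : w^~ x = iterate g h L Omega ^~ x).
      by rewrite /u patchT// inE.
    by apply/funext => k; rewrite /w patchT// inE.
  rewrite uout// (_ : w^~ x = fun=> 0) ?lim_cst//.
  by apply/funext => k; rewrite /w patchC// inE.
split=> // x.
  have wxM k : w k x <= M0 by case/andP: (wM k x).
  have [_ wl lM] := bounded_nondecreasing_cvg (wS^~ x) wxM.
  rewrite -(cvg_lim _ (wu x))// lM andbT (le_trans _ (wl 0%N))//.
  by case/andP: (wM 0%N x).
move=> Ox.
have wuS : w k.+1 x @[k --> \oo] --> u x by rewrite (cvg_shiftS (w^~ x)).
have lap : laplacian (w k.+1) x @[k --> \oo] --> laplacian u x.
  by rewrite (cvg_shiftS (fun k => laplacian (w k) x)); exact: cvg_laplacian.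
have Lw v : v k @[k --> \oo] --> u x -> L * v k @[k --> \oo] --> L * u x.
  by move=> vu; apply: cvgM => //; exact: cvg_cst.
(* In the limit the two L-terms cancel, leaving the nonlinear equation. *)
have rhs : laplacian (w k.+1) x @[k --> \oo] -->
    L * u x + (g (u x) - h x - L * u x).
  rewrite (_ : (fun k => laplacian (w k.+1) x) =
    (fun k => L * w k.+1 x + (g (w k x) - h x - L * w k x))); last first.
    by apply/funext => k; rewrite weq.
  apply: cvgD; first exact: Lw; apply: cvgB; last exact: Lw.
  apply: cvgB; last exact: cvg_cst.
  exact: (cvg_comp _ _ (wu x) (@gc _)).
by rewrite (cvgn_unique lap rhs); lra.
Qed.

(** Here v solves the equation with the smaller nonlinearity f. Where U_k > v, g(U_k) - f(v) >=
    f(U_k) - f(v) >= c (U_k - v), so comparison gives U_k <= v; this bound yields both convergence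
    and u <= v. *)
Lemma lattice_solutionP (P : set 'rV[int]_n) (Omega : nat -> set 'rV[int]_n)
    (f : R -> R) (v : 'rV[int]_n -> R) :
  exhaustion P Omega ->
  (forall t, 0 <= t -> f t <= g t) ->
  (forall s t, 0 <= s -> s <= t -> c * (t - s) <= f t - f s) ->
  (forall x, 0 <= v x) -> (forall x, laplacian v x = f (v x) - h x) ->
  let u := lattice_solution g h L Omega in
  (forall x, laplacian u x = g (u x) - h x) /\ (forall x, 0 <= u x <= v x).
Proof.
move=> [Ofin _ _ OS OT] fg f_incr v0 veq u.
pose U k := patch (fun=> 0) (Omega k) (domain_solution g h L (Omega k)).
have UM k x : 0 <= U k x <= M0 by have [+ _ _] := domain_solutionP (Ofin k); exact.
have Uout k x : ~ Omega k x -> U k x = 0 by have [_ + _] := domain_solutionP (Ofin k); exact.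
have Ueq k x : Omega k x -> laplacian (U k) x = g (U k x) - h x.
  by have [_ _] := domain_solutionP (Ofin k); exact.
have US k x : U k x <= U k.+1 x.
  apply: (comparison (Omega := Omega k) (K := M0) c0) x => x.
  - by move: (UM k x) (UM k.+1 x) => /andP[? ?] /andP[? ?]; lra.
  - by move=> /Uout ->; case/andP: (UM k.+1 x).
  (* On [Omega k] both functions solve the same equation, so the slope bound of g applies; off it
     [U k] is 0. *)
  - move=> Ox UU; rewrite !Ueq//; last exact: OS.
    case/andP: (UM k.+1 x) => U0 _; have := g_incr U0 (ltW UU); lra.
have Uv k x : U k x <= v x.
  apply: (comparison (Omega := Omega k) (K := M0) c0) x => x.
  - by move: (UM k x) (v0 x) => /andP[? ?] ?; lra.
  - by move=> /Uout ->.
  - move=> Ox vU; rewrite Ueq// veq.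
    case/andP: (UM k x) => U0 _.
    by have := f_incr _ _ (v0 x) (ltW vU); have := fg _ U0; lra.
have Ucvg x := bounded_nondecreasing_cvg (US^~ x) (Uv^~ x).
have Uu x : U k x @[k --> \oo] --> u x by case: (Ucvg x).
split=> x; last first.
  have [_ ul ->] := Ucvg x; rewrite andbT (le_trans _ (ul 0%N))//.
  by case/andP: (UM 0%N x).
have [N _ ONx] : (\bigcup_k Omega k) x by rewrite OT.
(* The equation for [U k] holds at x only once x has entered the domain, hence the shift by N. *)
have Olarge k : Omega (k + N)%N x by elim: k => // k /OS; rewrite addSn.
have lap : laplacian (U (k + N)%N) x @[k --> \oo] --> laplacian u x.
  by rewrite (cvg_shiftn N (fun k => laplacian (U k) x)); exact: cvg_laplacian.
have rhs : laplacian (U (k + N)%N) x @[k --> \oo] --> g (u x) - h x.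
  rewrite (_ : (fun k => laplacian (U (k + N)%N) x) =
    (fun k => g (U (k + N)%N x) - h x)); last first.
    by apply/funext => k; rewrite Ueq.
  apply: cvgB; last exact: cvg_cst.
  apply: (continuous_cvg _ (@gc _)).
  by rewrite (cvg_shiftn N (U^~ x)).
exact: cvgn_unique lap rhs.
Qed.

End MonotoneScheme.

(** * Exponential decay and uniqueness *)

Lemma dist_triangle (n : nat) (x y z : 'rV[int]_n) : dist x z <= dist x y + dist y z.
Proof. by rewrite /dist -big_split ler_sum// => i _; exact: ler_distD. Qed.

(** A neighbour is at most one step closer to the origin, so its value exceeds that at x by at most
    the factor e^m. *)
Lemma laplacian_exp_dist (R : realType) (n : nat) (m : R) (x : 'rV[int]_n) :
  0 <= m ->
  laplacian (fun y => expR (- m * (dist y 0)%:~R)) x <=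
  (2 * n)%:R * ((expR m - 1) * expR (- m * (dist x 0)%:~R)).
Proof.
move=> m0; apply: laplacian_le => [|y xy].
  by rewrite mulr_ge0 ?expR_ge0// subr_ge0 -expR0 ler_expR.
have dxy : (dist x 0)%:~R <= (dist y 0)%:~R + 1 :> R.
  by rewrite -(rmorphD _ _ 1) ler_int addrC -(eqP xy) dist_triangle.
rewrite mulrBl mul1r lerB// -expRD ler_expR.
by have := ler_wpM2l m0 dxy; lra.
Qed.

(* The barrier C e^{-m d} is a supersolution of the linearised equation at every
   site because d changes by at most 1 along an edge and e^m - 1 = c / (2n). *)
Lemma exp_decay (R : realType) (n : nat) (c K : R) (P : seq 'rV[int]_n)
    (u : 'rV[int]_n -> R) :
  (0 < n)%N -> 0 < c -> (forall x, u x <= K) -> (forall x, 0 <= u x) ->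
  (forall x, x \notin P -> c * u x <= laplacian u x) ->
  exists C : R, forall x,
    `|u x| <= C * expR (- ln (1 + c / (2 * n%:R)) * (dist x 0)%:~R).
Proof.
move=> n0 c0 uK u0 sub; set m := ln _.
pose w (y : 'rV[int]_n) := expR (- m * (dist y 0)%:~R).
have n2 : 0 < 2 * n%:R :> R by rewrite mulr_gt0 ?ltr0n.
have cn : 0 < c / (2 * n%:R) by rewrite divr_gt0.
have lapw x : laplacian w x <= c * w x.
  have m0 : 0 <= m by rewrite ln_ge0// lerDl ltW.
  apply: le_trans (laplacian_exp_dist x m0) _; rewrite -/(w x) lnK.
    by rewrite natrM addrAC subrr add0r mulrA mulrCA mulfV ?mulr1// gt_eqF.
  by rewrite posrE addr_gt0.
have w0 x : 0 < w x := expR_gt0 _.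
(* The sum of nonnegative ratios dominates each of them, so u <= C w on P; comparison then runs on
   the complement of P. *)
pose C := \sum_(q <- P) u q / w q.
have C0 : 0 <= C by apply: sumr_ge0 => q _; rewrite divr_ge0// ltW.
have CP q : q \in P -> u q <= C * w q.
  move=> qP; rewrite -ler_pdivrMr// /C (big_rem q)//= lerDl.
  by apply: sumr_ge0 => r _; rewrite divr_ge0// ltW.
have lapCw x : laplacian (fun y => C * w y) x = C * laplacian w x.
  by rewrite !laplacianE mulr_sumr; apply: eq_bigr => y _; rewrite mulrBr.
exists C => x; rewrite ger0_norm// -/(w x).
apply: (comparison (Omega := [set y | y \notin P]) (K := K) c0
  (v := fun y => C * w y)) x => x.
- have := mulr_ge0 C0 (ltW (w0 x)); have := uK x; lra.
- by move=> /negP; rewrite negbK => /CP.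
- move=> /= /sub ux _; rewrite lapCw.
  by have := ler_wpM2l C0 (lapw x); rewrite -/(w x) mulrCA mulrBr; lra.
Qed.

(** Where u > v >= 0 the slope bound gives c (u - v) <= f(u) - f(v), and the source cancels.
    Exchanging two bounded nonnegative solutions yields uniqueness. *)
Lemma bounded_solution_le (R : realType) (n : nat) (f : R -> R) (h : 'rV[int]_n -> R)
    (c : R) (u v : 'rV[int]_n -> R) :
  0 < c -> (forall s t, 0 <= s -> s <= t -> c * (t - s) <= f t - f s) ->
  bounded_fun u -> (forall x, 0 <= v x) ->
  (forall x, laplacian u x = f (u x) - h x) ->
  (forall x, laplacian v x = f (v x) - h x) ->
  forall x, u x <= v x.
Proof.
move=> c0 fi /bounded_fun_has_ubound[K uK] v0 ueq veq.
have {}uK x : u x <= K by apply: uK; exists x.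
apply: (comparison (Omega := setT) (K := K) c0) => x.
- by move: (uK x) (v0 x); lra.
- by move/(_ I).
- by move=> _ vu; rewrite ueq veq; have := fi _ _ (v0 x) (ltW vu); lra.
Qed.

Theorem theorem1p3 (R : realType) (n : nat) (hn : (2 <= n)%N)
  (lambda1 lambda2 A B : R)
  (hlambda1 : 0 < lambda1) (hlambda2 : 0 < lambda2) (hA : 0 < A) (hB : 0 < B)
  (hAB : 0 < lambda1 * A - lambda2 * B)
  (M : nat) (hM : (1 <= M)%N)
  (p : 'I_M -> 'rV[int]_n) (hp : injective p)
  (mult : 'I_M -> R) (hmult : forall j, 0 < mult j) :
  let h3 := vortex_source p mult in
  let g := nonlinearity lambda1 lambda2 A B in
  let m := ln (1 + (lambda1 * A - lambda2 * B) / (2 * n%:R)) in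
  exists ut : 'rV[int]_n -> R,
    [/\ unique (fun v : 'rV[int]_n -> R =>
          [/\ bounded_fun v,
              forall x, 0 <= v x &
              forall x, - laplacian v x + lambda1 * (expR (A * v x) - 1)
                        + lambda2 * (expR (- B * v x) - 1) - h3 x = 0]) ut,
        forall (M0 L : R) (Omega : nat -> set 'rV[int]_n),
          0 < M0 -> g M0 = 4 * pi * \big[Num.max/0]_(j < M) mult j ->
          0 < L ->
          (forall s t, 0 <= s -> s < t -> t <= M0 ->
             g t - L * t < g s - L * s) ->
          exhaustion (range p) Omega ->
          let u := lattice_solution g h3 L Omega in
          (forall x, - laplacian u x
             + lambda1 * expR (A * u x) * (expR (A * u x) - 1)
             + lambda2 * expR (- B * u x) * (expR (- B * u x) - 1)
             - h3 x = 0) /\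
          (forall x, 0 <= u x <= ut x) &
        exists C : R, forall x,
          `|ut x| <= C * expR (- m * (dist x 0)%:~R)].

Proof.
move=> h3 g m.
set c := lambda1 * A - lambda2 * B in hAB m *.
have [l10 l20 A0 B0] := And4 (ltW hlambda1) (ltW hlambda2) (ltW hA) (ltW hB).
have n0 : (0 < n)%N by exact: leq_trans hn.
pose f := exp_nonlinearity lambda1 lambda2 A B.
have f_incr s t : 0 <= s -> s <= t -> c * (t - s) <= f t - f s.
  exact: exp_nonlinearity_incr.
have f0 : f 0 = 0 := exp_nonlinearity0 _ _ _ _.
have h30 x : 0 <= h3 x by apply: vortex_source_ge0 => j; exact: ltW.
pose H := 4 * pi * \big[Num.max/0]_(j < M) mult j.
have h3H x : h3 x <= H := vortex_source_le _ _ hp.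
have H0 : 0 <= H by exact: le_trans (h30 0) (h3H 0).
have eqE (v : 'rV[int]_n -> R) : (forall x, - laplacian v x
    + lambda1 * (expR (A * v x) - 1) + lambda2 * (expR (- B * v x) - 1) - h3 x = 0)
    <-> (forall x, laplacian v x = f (v x) - h3 x).
  by split=> E x; have := E x; rewrite /f /exp_nonlinearity; lra.
(* The constant H / c is a supersolution: f(H / c) >= c (H / c) = H >= h3. Below, K is the one-sided
   Lipschitz constant of f up to H / c. *)
have Hc0 : 0 <= H / c by rewrite divr_ge0// ltW.
pose K := lambda1 * (A * expR (A * (H / c))).
have K0 : 0 < K by rewrite !mulr_gt0 ?expR_gt0.
(* The iteration runs on the whole lattice at once, with [Omega] equal to [setT]. *)
have [ut [utH uteq _]] : exists ut : 'rV[int]_n -> R,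
    [/\ forall x, 0 <= ut x <= H / c,
        forall x, setT x -> laplacian ut x = f (ut x) - h3 x &
        forall x, ~ setT x -> ut x = 0].
  apply: (exists_solution (F := fun x t => f t - h3 x) K0 Hc0) => [x _|x _|x s t s0 st tH|x t].
  - by rewrite f0 sub0r oppr_le0.
  - have := f_incr 0 _ (lexx 0) Hc0; rewrite f0 !subr0 mulrC divfK ?gt_eqF//.
    by rewrite subr_ge0; apply: le_trans.
  - have := exp_nonlinearity_lip l10 l20 A0 B0 st tH; rewrite -/f -/K; lra.
  - by apply: cvgB; [exact: continuous_exp_nonlinearity|exact: cvg_cst].
have {}uteq x : laplacian ut x = f (ut x) - h3 x by exact: uteq.
have ut0 x : 0 <= ut x by case/andP: (utH x).
have utK x : ut x <= H / c by case/andP: (utH x).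
have utb : bounded_fun ut.
  exists (H / c); split; first exact: num_real.
  by move=> k Hk x _ /=; rewrite ger0_norm// (le_trans (utK x))// ltW.
exists ut; split.
- split; first by split=> //; apply/eqE.
  move=> v [vb v0 /eqE veq]; apply/funext => x; apply/eqP; rewrite eq_le.
  by apply/andP; split; exact: (bounded_solution_le hAB f_incr).
- move=> M0 L Omega M00 gM0 L0 gL exh u.
  have gL' s t : 0 <= s -> s <= t -> t <= M0 -> g t - L * t <= g s - L * s.
    by move=> s0; rewrite le_eqVlt => /predU1P[->//|st] tM; exact/ltW/gL.
  have h3M0 x : h3 x <= g M0 by rewrite gM0.
  have [ueq uut] := lattice_solutionP hAB L0 (ltW M00) h30 h3M0
    (@continuous_nonlinearity _ _ _ _ _) (nonlinearity0 _ _ _ _)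
    (fun s t => nonlinearity_incr l10 l20 A0 B0) gL' exh
    (fun t _ => le_exp_nonlinearity A B t l10 l20) f_incr ut0 uteq.
  split=> // x.
  by have := ueq x; rewrite -/g -/u /g /nonlinearity; lra.
(* Off the vortices the source vanishes, so laplacian ut = f(ut) >= c ut there. *)
- apply: (exp_decay (P := [seq p j | j : 'I_M]) n0 hAB utK ut0) => x xP.
  rewrite uteq /h3 vortex_source_out => [|[j _ pjx]].
    by have := f_incr 0 _ (lexx 0) (ut0 x); rewrite f0 !subr0.
  by move/negP: xP; apply; apply/mapP; exists j; rewrite ?mem_enum.
Qed.
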